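(* Let $n,p\ge 1$ be integers, let $X\in\mathbb{R}^{n\times p}$ be any matrix, let $y\in\{0,1\}^n$, let $Q\in\mathbb{R}^{p\times p}$ be symmetric positive definite and let $v\in\mathbb{R}^p$. Let $k(\cdot,\cdot)$ be the transition density of the Albert–Chib data augmentation (AC-DA) Markov chain $\Psi$ on $\mathbb{R}^p$ determined by $(X,y,Q,v)$, and let $\nu(\beta)=\beta^T(X^TX+Q)\beta$ for $\beta\in\mathbb{R}^p$. Then there exist $\rho\in(0,1)$ and $L\in\mathbb{R}$ such that for every $\beta'\in\mathbb{R}^p$, $$\int_{\mathbb{R}^p}\nu(\beta)\,k(\beta',\beta)\,d\beta\le \rho\,\nu(\beta')+L.$$
   Context: Setting (Bayesian probit regression with proper normal prior). $X$ is an $n\times p$ real matrix whose $i$th row is $x_i^T$, $x_i\in\mathbb{R}^p$; $y=(y_1,\dots,y_n)^T\in\{0,1\}^n$ is the observed data; the prior on $\beta\in\mathbb{R}^p$ is $N_p(Q^{-1}v,Q^{-1})$. Let $\mathcal{Z}\subset\mathbb{R}^n$ be the Cartesian product of the $n$ half lines, the $i$th being $(0,\infty)$ if $y_i=1$ and $(-\infty,0]$ if $y_i=0$. Two conditional densities are used: - $\pi(\beta\mid z,y)$, for $z\in\mathcal{Z}$, is the density in $\beta$ of $N_p\big((X^TX+Q)^{-1}(v+X^Tz),\,(X^TX+Q)^{-1}\big)$. - $\pi(z\mid\beta,y)$, for $\beta\in\mathbb{R}^p$, is the density on $\mathcal{Z}$ under which $z_1,\dots,z_n$ are independent and $z_i$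 has the $N(x_i^T\beta,1)$ distribution truncated to $(0,\infty)$ if $y_i=1$ and to $(-\infty,0]$ if $y_i=0$. The AC-DA Markov chain $\Psi=(\beta_m)_{m\ge0}$ on $\mathbb{R}^p$ moves from current state $\beta'$ by drawing $z\sim\pi(\cdot\mid\beta',y)$ and then the new state $\beta\sim\pi(\cdot\mid z,y)$; its transition density is $$k(\beta',\beta)=\int_{\mathcal{Z}}\pi(\beta\mid z,y)\,\pi(z\mid\beta',y)\,dz .$$ *)

(* Defs.v *)
From HB Require Import structures.
From mathcomp Require Import all_boot all_order all_algebra.
From mathcomp Require Import all_classical all_reals all_analysis.

Set Implicit Arguments.
Unset Strict Implicit.
Unset Printing Implicit Defensive.

Import Order.TTheory GRing.Theory Num.Theory.
Import numFieldNormedType.Exports.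

Local Open Scope classical_set_scope.
Local Open Scope ring_scope.

(* The measurable space R^n is [n.-tuple R] with the product of the Borel
   sigma-algebras; its Lebesgue measure is built by recursion on n as the image
   of (Lebesgue on R) \x (Lebesgue on R^n) under (x, t) |-> x :: t. *)
Section lebesgue_tuple.
Variable R : realType.
Local Notation RR := (measurableTypeR R).

Definition cons_pair n (u : RR * n.-tuple RR) : n.+1.-tuple RR :=
  [the n.+1.-tuple RR of u.1 :: u.2].

Lemma measurable_cons_pair n : measurable_fun setT (@cons_pair n).
Proof. exact: measurable_cons. Qed.

Section lebesgue_cons.
Local Open Scope ereal_scope.
Variables (n : nat) (mu : {sigma_finite_measure set (n.-tuple RR) -> \bar R}).

Definition lebesgue_cons : set (n.+1.-tuple RR) -> \bar R :=
  pushforward (lebesgue_measure \x mu) (@cons_pair n).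

Let m : {measure set (n.+1.-tuple RR) -> \bar R} :=
  measure_function_pushforward__canonical__measure_function_Measure
    (lebesgue_measure \x mu) (@measurable_cons_pair n).

Let lebesgue_cons0 : lebesgue_cons set0 = 0.
Proof. exact: (measure0 m). Qed.

Let lebesgue_cons_ge0 A : 0 <= lebesgue_cons A.
Proof. exact: (measure_ge0 m). Qed.

Let lebesgue_cons_sigma_additive : semi_sigma_additive lebesgue_cons.
Proof. exact: (@measure_semi_sigma_additive _ _ _ m). Qed.

HB.instance Definition _ := isMeasure.Build _ _ _ lebesgue_cons
  lebesgue_cons0 lebesgue_cons_ge0 lebesgue_cons_sigma_additive.

Let lebesgue_cons_sigma_finite : sigma_finite setT lebesgue_cons.
Proof.
have /sigma_finiteP[F [FT ndF Foo]] := sigma_finiteT (@lebesgue_measure R).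
have /sigma_finiteP[G [GT ndG Goo]] := sigma_finiteT mu.
pose g (t : n.+1.-tuple RR) : RR * n.-tuple RR := (thead t, [tuple of behead t]).
have mg : measurable_fun setT g.
  apply/measurable_fun_pairP; split; first exact: measurable_tnth.
  exact: measurable_behead.
exists (fun k => g @^-1` (F k `*` G k)).
  apply/seteqP; split => // t _.
  have [i _ Fi] : (\bigcup_i F i) (g t).1 by rewrite -FT.
  have [j _ Gj] : (\bigcup_i G i) (g t).2 by rewrite -GT.
  exists (maxn i j) => //; split.
    by move: Fi; exact/subsetPset/ndF/leq_maxl.
  by move: Gj; exact/subsetPset/ndG/leq_maxr.
move=> k; have [mF Fk] := Foo k; have [mG Gk] := Goo k; split.
  by rewrite -[X in measurable X]setTI; apply: mg => //; exact: measurableX.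
rewrite /lebesgue_cons /pushforward -comp_preimage.
have -> : g \o @cons_pair n = id.
  by apply/funext => -[x t]; congr pair; exact/val_inj.
by rewrite preimage_id product_measure1E// lte_mul_pinfty// ge0_fin_numE.
Qed.

HB.instance Definition _ := Measure_isSigmaFinite.Build _ _ _ lebesgue_cons
  lebesgue_cons_sigma_finite.

End lebesgue_cons.

Fixpoint lebesgue_tuple n :
    {sigma_finite_measure set (n.-tuple RR) -> \bar R} :=
  match n with
  | 0 => \d_([tuple] : 0.-tuple RR)
  | m.+1 => lebesgue_cons (lebesgue_tuple m)
  end.

Lemma lebesgue_tuple_box n (A : 'I_n -> set RR) :
  (forall i, measurable (A i)) ->
  lebesgue_tuple n [set t | forall i, A i (tnth t i)] =
    (\prod_(i < n) lebesgue_measure (A i))%E.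
Proof.
elim: n A => [|n ih] A mA.
  rewrite big_ord0 /= diracE mem_set//= => -[].
  by case.
rewrite big_ord_recl -ih//.
rewrite [LHS]/= /lebesgue_cons /pushforward.
rewrite -product_measure1E//; last first.
  rewrite (_ : [set _ | _] = \bigcap_(i in [set: 'I_n])
      ((@tnth n RR ^~ i) @^-1` A (lift ord0 i))).
    apply: fin_bigcap_measurable => // i _.
    rewrite -[X in measurable X]setTI; exact: (measurable_tnth i).
  by apply/seteqP; split => [t h i _|t h i]; [exact: h|exact: (h i I)].
congr (_ _); apply/seteqP; split => -[x t]/= h.
  split => /= [|i]; first by have := h ord0; rewrite tnth0.
  by have := h (lift ord0 i); rewrite tnthS.
by case: h => /= h1 h2 i; have [j ->|->] := unliftP ord0 i;
  [rewrite tnthS|rewrite tnth0].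
Qed.

End lebesgue_tuple.

Section integration_over_Rn.
Variables (R : realType) (n : nat).

Definition col_tuple (t : n.-tuple (measurableTypeR R)) : 'cV[R]_n :=
  \col_i tnth t i.

Definition integral_cV (D : set 'cV[R]_n) (f : 'cV[R]_n -> \bar R) : \bar R :=
  (\int[lebesgue_tuple R n]_(t in col_tuple @^-1` D) f (col_tuple t))%E.

End integration_over_Rn.

Section gaussian_densities.
Variable R : realType.

Definition quad_form p (A : 'M[R]_p) (x : 'cV[R]_p) : R :=
  (x^T *m A *m x) 0 0.

Definition sym_posdef p (A : 'M[R]_p) : Prop :=
  A^T = A /\ forall x : 'cV[R]_p, x != 0 -> 0 < quad_form A x.

(* S is the covariance matrix, not the precision. *)
Definition mvnormal_pdf p (m : 'cV[R]_p) (S : 'M[R]_p) (x : 'cV[R]_p) : R :=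
  (Num.sqrt ((2 * pi) ^+ p * \det S))^-1
    * expR (- quad_form (invmx S) (x - m) / 2).

(* N(m, 1) conditioned on A; the scale parameter of normal_pdf is the standard
   deviation. *)
Definition truncnormal_pdf (m : R) (A : set R) (x : R) : R :=
  \1_A x * (normal_pdf m 1 x / fine (normal_prob m 1 A)).

End gaussian_densities.

Section albert_chib.
Variables (R : realType) (n p : nat).
Variables (X : 'M[R]_(n, p)) (y : 'I_n -> bool) (Q : 'M[R]_p) (v : 'cV[R]_p).

Definition half_line (b : bool) : set R :=
  if b then `]0, +oo[%classic else `]-oo, 0]%classic.

Definition latent_space : set 'cV[R]_n :=
  [set z | forall i, half_line (y i) (z i 0)].

(* pi(beta | z, y) *)
Definition beta_cond_pdf (z : 'cV[R]_n) (beta : 'cV[R]_p) : R :=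
  mvnormal_pdf (invmx (X^T *m X + Q) *m (v + X^T *m z))
    (invmx (X^T *m X + Q)) beta.

(* pi(z | beta, y): the i-th entry of X *m beta is x_i^T beta. *)
Definition latent_cond_pdf (beta : 'cV[R]_p) (z : 'cV[R]_n) : R :=
  \prod_(i < n) truncnormal_pdf ((X *m beta) i 0) (half_line (y i)) (z i 0).

(* k(beta', beta), extended-real valued as an integral of a nonnegative
   function. *)
Definition acda_density (beta' beta : 'cV[R]_p) : \bar R :=
  integral_cV latent_space
    (fun z => (beta_cond_pdf z beta * latent_cond_pdf beta' z)%:E).

Definition drift_fun (beta : 'cV[R]_p) : R := quad_form (X^T *m X + Q) beta.

End albert_chib.

(* Main.v *)
Require Import Defs.
From mathcomp Require Import all_boot all_order all_algebra.
From mathcomp Require Import all_classical all_reals all_analysis.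
From mathcomp Require Import measurable_realfun measurable_fun_approximation.
From mathcomp Require Import ring lra.

Set Implicit Arguments.
Unset Strict Implicit.
Unset Printing Implicit Defensive.

Import Order.TTheory GRing.Theory Num.Theory.
Import numFieldNormedType.Exports.

Local Open Scope classical_set_scope.
Local Open Scope ring_scope.

(* Put A = X^T X + Q and m(z) = A^-1 (v + X^T z). By Tonelli the left-hand side
   is the mean, over z ~ pi(z | beta', y), of E[nu(beta) | z].
   - Young's inequality nu(beta) <= (1+e) nu(m(z)) + (1+1/e) nu(beta - m(z))
     and t exp(-t/2) <= 4 exp(-t/4) reduce E[nu(beta) | z] <= (1+e) nu(m(z)) + K
     to the value of the Gaussian integral, which is computed one coordinate at
     a time by taking Schur complements.
   - Since Q is positive definite, |X u|^2 <= lam nu(u) for some lam < 1, whence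
     nu(m(z)) <= |z|^2 + C.
   - A N(mu, 1) variable truncated to a half-line ending at 0 has second moment
     at most 2 + mu^2, so E|z|^2 <= |X beta'|^2 + 2n <= lam nu(beta') + 2n.
   With e = 1 - lam this gives rho = lam (2 - lam). *)

(** * Quadratic forms of symmetric positive definite matrices *)

Section positive_definite.
Context {R : realType}.

Lemma mulmx_col1E n (u w : 'cV[R]_n) : (u^T *m w) 0 0 = \sum_i u i 0 * w i 0.
Proof. by rewrite mxE; apply: eq_bigr => i _; rewrite mxE. Qed.

Lemma quad_formD n (A : 'M[R]_n) (u w : 'cV[R]_n) : A^T = A ->
  quad_form A (u + w) = quad_form A u + 2 * (u^T *m A *m w) 0 0 + quad_form A w.
Proof.
move=> symA; rewrite /quad_form [(u + w)^T]linearD /= !mulmxDl !mulmxDr.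
rewrite [w^T *m A *m u](_ : _ = (u^T *m A *m w)^T); last first.
  by rewrite !trmx_mul symA trmxK mulmxA.
have addE (B C : 'M[R]_1) : (B + C) 0 0 = B 0 0 + C 0 0 by rewrite mxE.
by rewrite !addE [(_^T) 0 0]mxE; ring.
Qed.

Lemma quad_formZ n (A : 'M[R]_n) (s : R) (u : 'cV[R]_n) :
  quad_form A (s *: u) = s ^+ 2 * quad_form A u.
Proof.
by rewrite /quad_form [(s *: u)^T]linearZ /= -scalemxAr -!scalemxAl scalerA mxE expr2.
Qed.

Lemma quad_formZmx n (A : 'M[R]_n) (s : R) (u : 'cV[R]_n) :
  quad_form (s *: A) u = s * quad_form A u.
Proof. by rewrite /quad_form -scalemxAr -!scalemxAl mxE. Qed.

Lemma quad_form1 n (u : 'cV[R]_n) : quad_form 1%:M u = \sum_i u i 0 ^+ 2.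
Proof. by rewrite /quad_form mulmx1 mulmx_col1E. Qed.

Lemma quad_form_gram m n (X : 'M[R]_(m, n)) (u : 'cV[R]_n) :
  quad_form (X^T *m X) u = \sum_i (X *m u) i 0 ^+ 2.
Proof. by rewrite -quad_form1 /quad_form mulmx1 trmx_mul !mulmxA. Qed.

Lemma quad_formDmx n (A B : 'M[R]_n) (u : 'cV[R]_n) :
  quad_form (A + B) u = quad_form A u + quad_form B u.
Proof. by rewrite /quad_form mulmxDr mulmxDl mxE. Qed.

Lemma quad_form0 n (A : 'M[R]_n) : quad_form A 0 = 0.
Proof. by rewrite /quad_form mulmx0 mxE. Qed.

Lemma quad_form_ge0 n (A : 'M[R]_n) (u : 'cV[R]_n) :
  sym_posdef A -> 0 <= quad_form A u.
Proof.
move=> [_ posA]; have [->|/posA/ltW//] := eqVneq u 0.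
by rewrite quad_form0.
Qed.

(** The form is nonnegative at e u - w; expanding this bounds twice the cross term by e q(u) + q(w)
    / e, where q is the form of [A]. *)
Lemma quad_form_young n (A : 'M[R]_n) (e : R) (u w : 'cV[R]_n) :
  sym_posdef A -> 0 < e ->
  quad_form A (u + w) <= (1 + e) * quad_form A u + (1 + e^-1) * quad_form A w.
Proof.
move=> pA e0; have [symA _] := pA.
have := quad_form_ge0 (e *: u + (-1) *: w) pA.
rewrite !quad_formD// !quad_formZ sqrrN expr1n mul1r.
have -> : ((e *: u)^T *m A *m (-1 *: w)) 0 0 = - (e * (u^T *m A *m w) 0 0).
  by rewrite [(e *: u)^T]linearZ /= -!scalemxAl -scalemxAr scaleN1r scalerN !mxE.
set c := (_ *m w) 0 0; move=> h.
rewrite -(ler_pM2l e0).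
have -> : e * ((1 + e) * quad_form A u + (1 + e^-1) * quad_form A w) =
    e * (1 + e) * quad_form A u + (e + 1) * quad_form A w.
  by field; rewrite gt_eqF.
lra.
Qed.

(** A row of the left kernel, transposed, has zero quadratic form, so it vanishes. *)
Lemma sym_posdef_unitmx n (A : 'M[R]_n) : sym_posdef A -> A \in unitmx.
Proof.
move=> [symA posA]; rewrite -row_free_unit -kermx_eq0.
apply/eqP/row_matrixP => i; rewrite row0.
set u := row i _; have uA : u *m A = 0.
  by apply/sub_kermxP; rewrite row_sub.
apply/trmx_inj; rewrite trmx0; apply/eqP/negP => /negP /posA.
by rewrite /quad_form trmxK uA mul0mx mxE ltxx.
Qed.

Lemma sym_posdefZ n (A : 'M[R]_n) (s : R) :
  0 < s -> sym_posdef A -> sym_posdef (s *: A).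
Proof.
move=> s0 [symA posA]; split; first by rewrite linearZ /= symA.
by move=> u /posA Au; rewrite quad_formZmx mulr_gt0.
Qed.

Lemma sym_posdef_gramD m n (X : 'M[R]_(m, n)) (Q : 'M[R]_n) :
  sym_posdef Q -> sym_posdef (X^T *m X + Q).
Proof.
move=> [symQ posQ]; split.
  by rewrite linearD /= trmx_mul trmxK symQ.
move=> u /posQ Qu; rewrite quad_formDmx quad_form_gram ltr_wpDl//.
by apply: sumr_ge0 => i _; exact: sqr_ge0.
Qed.

(* Positivity of the form at u - s A^-1 w. *)
Lemma quad_form_fenchel n (A : 'M[R]_n) (s : R) (u w : 'cV[R]_n) :
  sym_posdef A ->
  2 * s * (u^T *m w) 0 0 <= quad_form A u + s ^+ 2 * quad_form (invmx A) w.
Proof.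
move=> pA; have uA := sym_posdef_unitmx pA; have [symA _] := pA.
have := quad_form_ge0 (u + (- s) *: (invmx A *m w)) pA.
rewrite quad_formD// quad_formZ sqrrN.
rewrite -scalemxAr mxE mulmxA mulmxK//.
rewrite [quad_form A (_ *m w)](_ : _ = quad_form (invmx A) w); first lra.
by rewrite /quad_form trmx_mul trmx_inv symA !mulmxA mulmxKV.
Qed.

(** This is the preceding inequality at s = 1 and u = 0. *)
Lemma quad_form_inv_ge0 n (A : 'M[R]_n) (w : 'cV[R]_n) :
  sym_posdef A -> 0 <= quad_form (invmx A) w.
Proof.
move=> /(quad_form_fenchel 1 0 w).
by rewrite quad_form0 trmx0 mul0mx mxE mulr0 add0r expr1n mul1r.
Qed.

(** The source of the contraction. With K above every x_i^T Q^-1 x_i, a Cauchy-Schwarz argument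
    gives (x_i^T u)^2 <= K u^T Q u. Summing over the rows, |X u|^2 <= T u^T Q u, which is the same
    as |X u|^2 <= T / (1 + T) (|X u|^2 + u^T Q u). *)
Lemma gram_bound m n (X : 'M[R]_(m, n)) (Q : 'M[R]_n) : sym_posdef Q ->
  exists2 lam : R, 0 < lam < 1 & forall u : 'cV[R]_n,
    \sum_i (X *m u) i 0 ^+ 2 <= lam * quad_form (X^T *m X + Q) u.
Proof.
move=> pQ.
pose K := 1 + \sum_i quad_form (invmx Q) (col i X^T).
have K0 : 0 < K.
  by rewrite ltr_pwDl// sumr_ge0// => i _; exact: quad_form_inv_ge0.
have Ki i : quad_form (invmx Q) (col i X^T) <= K.
  rewrite /K (bigD1 i)//= addrCA lerDl addr_ge0// sumr_ge0// => j _.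
  exact: quad_form_inv_ge0.
have XK u i : (X *m u) i 0 ^+ 2 <= K * quad_form Q u.
  have -> : (X *m u) i 0 = (u^T *m col i X^T) 0 0.
    by rewrite mulmx_col1E mxE; apply: eq_bigr => j _; rewrite !mxE mulrC.
  set x := _ 0 0.
  (* The choice s = x / K maximises 2 s x - s^2 K, whose maximum is x^2 / K. *)
  have := quad_form_fenchel (x / K) u (col i X^T) pQ; rewrite -/x => h.
  have : 2 * (x / K) * x <= quad_form Q u + (x / K) ^+ 2 * K.
    by apply: (le_trans h); rewrite lerD2l ler_wpM2l ?sqr_ge0.
  have -> : (x / K) ^+ 2 * K = x ^+ 2 / K by field; rewrite gt_eqF.
  have -> : 2 * (x / K) * x = 2 * (x ^+ 2 / K) by ring.
  move=> {}h; have : x ^+ 2 / K <= quad_form Q u by lra.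
  by rewrite ler_pdivrMr// mulrC.
(* The summand 1 keeps [T] positive even for m = 0, so that T / (1 + T) is strictly between 0 and
   1. *)
pose T := 1 + m%:R * K.
have mK0 : 0 <= m%:R * K by rewrite mulr_ge0 ?ler0n ?ltW.
have T0 : 0 < T by rewrite /T; lra.
exists (T / (1 + T)).
  by rewrite divr_gt0/= ?ltr_pdivrMr; lra.
move=> u; rewrite mulrAC ler_pdivlMr; last lra.
rewrite quad_formDmx quad_form_gram; set S := \sum_i _.
have S1 : S <= m%:R * K * quad_form Q u.
  have -> : m%:R * K * quad_form Q u = \sum_(i < m) K * quad_form Q u.
    by rewrite sumr_const card_ord -mulrA mulr_natl.
  exact: ler_sum.
have := quad_form_ge0 u pQ; rewrite /T; nra.
Qed.

(** For u = A^-1 (v + X^T z) the form of [A] at u equals u^T v + (X u)^T z. The second term is at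
    most (|X u|^2 + |z|^2) / 2, hence costs a share lam / 2 of the form; the first is bounded at a
    share (1 - lam) / 2. Half of the form remains on the left. *)
Lemma posterior_mean_bound m n (X : 'M[R]_(m, n)) (Q : 'M[R]_n)
    (v : 'cV[R]_n) : sym_posdef Q ->
  exists lam C : R, [/\ 0 < lam < 1, 0 <= C,
    (forall u : 'cV[R]_n,
      \sum_i (X *m u) i 0 ^+ 2 <= lam * quad_form (X^T *m X + Q) u) &
    (forall z : 'cV[R]_m,
      quad_form (X^T *m X + Q) (invmx (X^T *m X + Q) *m (v + X^T *m z))
        <= \sum_i z i 0 ^+ 2 + C)].
Proof.
move=> pQ; have [lam lam01 Xlam] := gram_bound X pQ.
have /andP[lam0 lam1] := lam01.
have pA := sym_posdef_gramD X pQ.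
set A := X^T *m X + Q in pA *.
exists lam, (quad_form (invmx A) v / (1 - lam)).
split => //; first by rewrite divr_ge0 ?quad_form_inv_ge0//; lra.
move=> z; set u := invmx A *m _.
have uA := sym_posdef_unitmx pA.
have quE : quad_form A u = (u^T *m v) 0 0 + \sum_i (X *m u) i 0 * z i 0.
  rewrite /quad_form -mulmxA mulKVmx// mulmxDr mxE; congr (_ + _).
  by rewrite mulmxA -trmx_mul mulmx_col1E.
have h1 : \sum_i (X *m u) i 0 * z i 0 <=
    (\sum_i (X *m u) i 0 ^+ 2 + \sum_i z i 0 ^+ 2) / 2.
  rewrite -big_split /= mulr_suml; apply: ler_sum => i _.
  have := sqr_ge0 ((X *m u) i 0 - z i 0); nra.
have h2 := Xlam u.
(* After multiplication by 1 - lam this parameter gives the form the coefficient 1 - lam,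
   complementary to [lam] in [h2]. *)
have h3 := quad_form_fenchel (1 - lam)^-1 u v pA.
have l1 : 0 < 1 - lam by lra.
have {}h3 : 2 * (u^T *m v) 0 0 <=
    (1 - lam) * quad_form A u + quad_form (invmx A) v / (1 - lam).
  rewrite -(ler_pM2l (x := (1 - lam)^-1)) ?invr_gt0//.
  apply: le_trans (le_trans h3 _); first by rewrite le_eqVlt; apply/orP; left; apply/eqP; ring.
  by rewrite le_eqVlt; apply/orP; left; apply/eqP; field; rewrite gt_eqF.
rewrite -/A in h2.
set q := quad_form A u in quE h2 h3 *.
set q' := _ / (1 - lam) in h3 *.
set S := \sum_i z i 0 ^+ 2 in h1 *.
lra.
Qed.

End positive_definite.

(** * Measurability of vector-valued maps *)

Section measurable_vectors.
Context {R : realType} d {T : measurableType d}.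

(** Measurability is taken coordinatewise, so no sigma-algebra on column vectors has to be
    chosen. *)
Definition measurable_col n (f : T -> 'cV[R]_n) :=
  forall i, measurable_fun setT (fun t => f t i 0).

Lemma measurable_col_cst n (u : 'cV[R]_n) : measurable_col (cst u).
Proof. by move=> i; exact: measurable_cst. Qed.

Lemma measurable_colD n (f g : T -> 'cV[R]_n) :
  measurable_col f -> measurable_col g ->
  measurable_col (fun t => f t + g t).
Proof.
move=> mf mg i; under eq_fun do rewrite mxE.
exact: measurable_funD.
Qed.

Lemma measurable_colN n (f : T -> 'cV[R]_n) :
  measurable_col f -> measurable_col (fun t => - f t).
Proof.
move=> mf i; under eq_fun do rewrite mxE.
exact: measurableT_comp.
Qed.

Lemma measurable_col_mulmx m n (A : 'M[R]_(m, n)) (f : T -> 'cV[R]_n) :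
  measurable_col f -> measurable_col (fun t => A *m f t).
Proof.
move=> mf i; under eq_fun do rewrite mxE.
by apply: measurable_sum => j; exact: measurable_funM.
Qed.

Lemma measurable_quad_form n (A : 'M[R]_n) (f : T -> 'cV[R]_n) :
  measurable_col f -> measurable_fun setT (fun t => quad_form A (f t)).
Proof.
move=> mf; rewrite /quad_form.
under eq_fun do rewrite -mulmxA mulmx_col1E.
by apply: measurable_sum => j; apply: measurable_funM => //;
  exact: measurable_col_mulmx.
Qed.

End measurable_vectors.

(** * Iterated integration over tuples *)

Section tuple_integration.
Context {R : realType}.
Local Notation RR := (measurableTypeR R).
Local Open Scope ereal_scope.

Lemma measurable_col_tuple n : measurable_col (@col_tuple R n).
Proof.
move=> i; rewrite (_ : (fun _ => _) = (fun t : n.-tuple RR => tnth t i)).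
  exact: measurable_tnth.
by apply/funext => t; rewrite mxE.
Qed.

Lemma ge0_integral_lebesgue_tuple0 (f : 0.-tuple RR -> \bar R) :
  measurable_fun setT f -> \int[lebesgue_tuple R 0]_t f t = f [tuple].
Proof. by move=> mf; rewrite integral_dirac// diracT mul1e. Qed.

(** The measure on the longer tuples is the image of a product measure, so this is a change of
    variables followed by Tonelli, with the first coordinate integrated innermost. *)
Lemma ge0_integral_lebesgue_tupleS n (f : n.+1.-tuple RR -> \bar R) :
  measurable_fun setT f -> (forall t, 0 <= f t) ->
  \int[lebesgue_tuple R n.+1]_t f t =
  \int[lebesgue_tuple R n]_t
    \int[lebesgue_measure]_x f (cons_pair (x, t)).
Proof.
move=> mf f0.
have mc := @measurable_cons_pair R n.
transitivity (\int[lebesgue_measure \x lebesgue_tuple R n]_u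
    (f \o @cons_pair R n) u).
  exact: (ge0_integral_pushforward mc (lebesgue_measure \x lebesgue_tuple R n)).
rewrite fubini_tonelli2//; first exact: measurableT_comp.
by move=> u; exact: f0.
Qed.

(** Puts the vector in the block form to which Schur complements apply. *)
Lemma col_tuple_cons n x (t : n.-tuple RR) :
  col_tuple (cons_pair (x, t)) = col_mx x%:M (col_tuple t) :> 'cV_(1 + n).
Proof.
apply/colP => i; rewrite mxE; case: (split_ordP i) => j ->.
  by rewrite col_mxEu ord1 !mxE.
rewrite col_mxEd mxE.
by rewrite (_ : rshift 1 j = lift ord0 j) ?tnthS//; exact: val_inj.
Qed.

(** Induction on n: the factor of the first coordinate is constant in the others, and their product
    is constant in the first. This is how independence of the latent variables enters. *)
Lemma ge0_integral_lebesgue_tuple_prod n (f : 'I_n -> RR -> R) :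
  (forall i, measurable_fun setT (f i)) -> (forall i x, (0 <= f i x)%R) ->
  \int[lebesgue_tuple R n]_t (\prod_i f i (tnth t i))%:E =
  \prod_i \int[lebesgue_measure]_x (f i x)%:E.
Proof.
have mprod k (g : 'I_k -> RR -> R) : (forall i, measurable_fun setT (g i)) ->
    measurable_fun setT (fun t : k.-tuple RR => \prod_i g i (tnth t i))%R.
  move=> mg; apply: measurable_prod => i _.
  exact: (measurableT_comp (mg i) (measurable_tnth i)).
elim: n f => [|n IH] f mf f0.
  rewrite ge0_integral_lebesgue_tuple0 ?big_ord0//.
  by apply/measurable_EFinP; exact: mprod.
rewrite ge0_integral_lebesgue_tupleS; first last.
- by move=> t; rewrite lee_fin prodr_ge0.
- by apply/measurable_EFinP; exact: mprod.
rewrite big_ord_recl -IH//.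
transitivity (\int[lebesgue_tuple R n]_t (\int[lebesgue_measure]_x (f ord0 x)%:E *
    (\prod_i f (lift ord0 i) (tnth t i))%:E)).
  apply: eq_integral => t _; rewrite -ge0_integralZr//; first last.
  - by rewrite lee_fin prodr_ge0.
  - by move=> x _; rewrite lee_fin.
  - by apply/measurable_EFinP; exact: mf.
  apply: eq_integral => x _; rewrite big_ord_recl tnth0 EFinM.
  by congr (_ * _%:E); apply: eq_bigr => i _; rewrite tnthS.
rewrite /= ge0_integralZl//.
- apply/measurable_EFinP; apply: (mprod n (fun i => f (lift ord0 i))) => i.
  exact: mf.
- by move=> x _; rewrite lee_fin prodr_ge0.
- by apply: integral_ge0 => x _; rewrite lee_fin.
Qed.

End tuple_integration.

(** * Schur complements *)

Section schur_complement.
Context {R : realType}.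

(** The complement of the top-left entry. The transposed lower-left block stands for the upper-right
    one, with which it agrees when [A] is symmetric. *)
Definition schur_compl p (A : 'M[R]_(1 + p)) : 'M[R]_p :=
  drsubmx A - (ulsubmx A 0 0)^-1 *: (dlsubmx A *m (dlsubmx A)^T).

(** Completion of the square in the first coordinate. *)
Lemma quad_form_schur p (A : 'M[R]_(1 + p)) (x : R) (u : 'cV[R]_p) :
  A^T = A -> ulsubmx A 0 0 != 0 ->
  quad_form A (col_mx x%:M u) =
  ulsubmx A 0 0 * (x + ((dlsubmx A)^T *m u) 0 0 / ulsubmx A 0 0) ^+ 2 +
  quad_form (schur_compl A) u.
Proof.
move=> symA a0; rewrite /schur_compl.
have urE : ursubmx A = (dlsubmx A)^T by rewrite trmx_dlsub symA.
have ulE := mx11_scalar (ulsubmx A).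
set a := ulsubmx A 0 0 in a0 ulE *.
set b := dlsubmx A in urE *; set D := drsubmx A.
rewrite -(submxK A) ulE urE -/b -/D.
have addE (B C : 'M[R]_1) : (B + C) 0 0 = B 0 0 + C 0 0 by rewrite mxE.
have oppE (B : 'M[R]_1) : (- B) 0 0 = - B 0 0 by rewrite mxE.
have sclE c (B : 'M[R]_1) : (c *: B) 0 0 = c * B 0 0 by rewrite mxE.
rewrite /quad_form tr_col_mx mul_row_block mul_row_col tr_scalar_mx.
rewrite !mul_mx_scalar !mul_scalar_mx [in RHS]mulmxBr [in RHS]mulmxBl mulmxDl.
rewrite -scalemxAl -scalemxAr -scalemxAl !addE oppE !sclE !addE !sclE.
rewrite [_%:M 0 0]mxE eqxx mulr1n.
rewrite (mulmxA u^T b) -(mulmxA (u^T *m b)) [(_ *m (b^T *m u)) 0 0]mxE big_ord1.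
have -> : (u^T *m b) 0 0 = (b^T *m u) 0 0.
  by rewrite !mulmx_col1E; under eq_bigr do rewrite mulrC.
by field.
Qed.

(** One step of block elimination: [A] is a unit lower triangular matrix times a block upper
    triangular one with diagonal blocks a and the Schur complement. *)
Lemma det_schur p (A : 'M[R]_(1 + p)) : A^T = A -> ulsubmx A 0 0 != 0 ->
  \det A = ulsubmx A 0 0 * \det (schur_compl A).
Proof.
move=> symA a0; rewrite /schur_compl.
have urE : ursubmx A = (dlsubmx A)^T by rewrite trmx_dlsub symA.
have ulE := mx11_scalar (ulsubmx A).
set a := ulsubmx A 0 0 in a0 ulE *.
set b := dlsubmx A in urE *; set D := drsubmx A.
rewrite -(submxK A) ulE urE -/b -/D.
transitivity (\det (block_mx 1%:M 0 (a^-1 *: b) 1%:M *m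
                    block_mx a%:M b^T 0 (D - a^-1 *: (b *m b^T)))).
  congr (\det _); rewrite mulmx_block !mul1mx !mul0mx !addr0.
  by rewrite mul_mx_scalar scalerA divff// scale1r -scalemxAl subrKC.
by rewrite det_mulmx det_lblock det_ublock !det1 !mul1r det_scalar1.
Qed.

Lemma sym_posdef_ul_gt0 p (A : 'M[R]_(1 + p)) :
  sym_posdef A -> 0 < ulsubmx A 0 0.
Proof.
move=> [symA posA]; have := posA (col_mx 1%:M 0).
rewrite -{1}(submxK A) /quad_form tr_col_mx mul_row_block mul_row_col.
rewrite trmx1 trmx0 !mul0mx !mulmx0 !addr0 mul1mx mulmx1; apply.
by rewrite col_mx_eq0 negb_and; apply/orP; left; exact: oner_neq0.
Qed.

(** The form of the complement at u is the form of [A] at the vector extending u by the first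
    coordinate that makes the completed square vanish. *)
Lemma sym_posdef_schur p (A : 'M[R]_(1 + p)) :
  sym_posdef A -> sym_posdef (schur_compl A).
Proof.
move=> pA; have a0 := lt0r_neq0 (sym_posdef_ul_gt0 pA).
have [symA posA] := pA; split.
  rewrite /schur_compl linearB /= linearZ /= trmx_mul trmxK.
  by rewrite trmx_drsub symA.
move=> u u0; set a := ulsubmx A 0 0 in a0.
pose w : 'cV[R]_(1 + p) := col_mx (- (((dlsubmx A)^T *m u) 0 0 / a))%:M u.
have -> : quad_form (schur_compl A) u = quad_form A w.
  by rewrite quad_form_schur// addNr expr0n mulr0 add0r.
by apply: posA; rewrite col_mx_eq0 negb_and u0 orbT.
Qed.

Lemma sym_posdef_det_gt0 p (A : 'M[R]_p) : sym_posdef A -> 0 < \det A.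
Proof.
elim: p A => [|p IH] A pA; first by rewrite det_mx00.
have a0 := sym_posdef_ul_gt0 (pA : @sym_posdef R (1 + p) A).
rewrite (@det_schur p A) ?gt_eqF//; last by case: pA.
by rewrite mulr_gt0// IH//; exact: sym_posdef_schur.
Qed.

End schur_complement.

(** * The multivariate Gaussian integral *)

Section gaussian_integral.
Context {R : realType}.
Local Notation RR := (measurableTypeR R).
Local Open Scope ereal_scope.

(** The integrand is a multiple of the normal density with mean -m and variance 1 / a. *)
Lemma integral_expR_sqr (a m : R) : (0 < a)%R ->
  \int[lebesgue_measure]_(x in [set: RR]) (expR (- (a * (x + m) ^+ 2) / 2))%:E =
  (Num.sqrt (2 * pi / a))%:E.
Proof.
move=> a0; have sa0 : (0 < Num.sqrt a)%R by rewrite sqrtr_gt0.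
pose s := (Num.sqrt a)^-1%R.
have s0 : s != 0%R by rewrite invr_neq0// gt_eqF.
have s2 : (s ^+ 2 = a^-1)%R by rewrite exprVn sqr_sqrtr// ltW.
transitivity (\int[lebesgue_measure]_(x in [set: RR])
    ((Num.sqrt (2 * pi / a))%:E * (normal_pdf (- m) s x)%:E)).
  apply: eq_integral => x _; rewrite normal_pdfE// /normal_peak /normal_fun s2.
  rewrite -EFinM opprK (_ : a^-1 * pi *+ 2 = 2 * pi / a)%R; last ring.
  rewrite mulVKf; last first.
    by rewrite gt_eqF// sqrtr_gt0 divr_gt0// mulr_gt0// pi_gt0.
  by congr (expR _)%:E; field; rewrite gt_eqF.
rewrite ge0_integralZl//.
- by rewrite integral_normal_pdf mule1.
- by apply/measurable_EFinP; exact: measurable_normal_pdf.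
- by move=> x _; rewrite lee_fin normal_pdf_ge0.
Qed.

Lemma measurable_gaussian d (T : measurableType d) p (A : 'M[R]_p)
    (f : T -> 'cV[R]_p) : measurable_col f ->
  measurable_fun setT (fun t => expR (- quad_form A (f t) / 2)).
Proof.
move=> mf; apply: measurableT_comp => //.
apply: measurable_funM => //; apply: measurableT_comp => //.
exact: measurable_quad_form.
Qed.

Lemma measurable_col_tupleB p (m : 'cV[R]_p) :
  measurable_col (fun t => col_tuple t - m)%R.
Proof.
apply: measurable_colD; first exact: measurable_col_tuple.
exact: measurable_col_cst.
Qed.

(** Induction on p. Completing the square, the first coordinate contributes sqrt (2 pi / a), the
    others a Gaussian integral for the Schur complement, and the determinants multiply. *)
Lemma integral_gaussian p (A : 'M[R]_p) (m : 'cV[R]_p) : sym_posdef A ->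
  \int[lebesgue_tuple R p]_t (expR (- quad_form A (col_tuple t - m) / 2))%:E =
  (Num.sqrt ((2 * pi) ^+ p / \det A))%:E.
Proof.
elim: p A m => [|p IH] A m pA.
  rewrite ge0_integral_lebesgue_tuple0; last first.
    apply/measurable_EFinP; apply: measurable_gaussian.
    exact: measurable_col_tupleB.
  by rewrite /quad_form mxE big_ord0 oppr0 mul0r expR0 det_mx00 divr1 sqrtr1.
rewrite ge0_integral_lebesgue_tupleS; first last.
- by move=> t; rewrite lee_fin expR_ge0.
- apply/measurable_EFinP; apply: measurable_gaussian.
  exact: measurable_col_tupleB.
(* The convertible dimension [1 + p] makes the block operations available. *)
pose B : 'M[R]_(1 + p) := A; pose k : 'cV[R]_(1 + p) := m.
have pB : sym_posdef B by exact: pA.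
have a0 := sym_posdef_ul_gt0 pB; have [symB _] := pB.
set a := (ulsubmx B 0 0)%R in a0.
have pi20 : (0 < 2 * pi :> R)%R by rewrite mulr_gt0// pi_gt0.
transitivity (\int[lebesgue_tuple R p]_t
    ((Num.sqrt (2 * pi / a))%:E *
     (expR (- quad_form (schur_compl B) (col_tuple t - dsubmx k)%R / 2))%:E)).
  apply: eq_integral => t _; set u := (_ - _)%R.
  (* The shift [c] depends on [t], but the integral over the first coordinate does not depend on the
     shift. *)
  pose c := (((dlsubmx B)^T *m u) 0 0 / a)%R.
  rewrite -(integral_expR_sqr (c - usubmx k 0 0)%R a0) -ge0_integralZr//.
  - apply: eq_integral => x _; rewrite col_tuple_cons -EFinM -expRD.
    congr (expR _)%:E.
    have -> : (col_mx x%:M (col_tuple t) - m)%R =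
        (col_mx (x - usubmx k 0 0)%:M u)%R.
      rewrite -[X in (_ - X)%R](vsubmxK k) opp_col_mx add_col_mx.
      by rewrite {1}(mx11_scalar (usubmx k)) raddfB.
    rewrite -/B quad_form_schur ?gt_eqF// -/c -/a; lra.
  - apply/measurable_EFinP; apply: measurableT_comp => //.
    apply: measurable_funM => //; apply: measurableT_comp => //.
    apply: measurable_funM => //; apply: measurable_funX.
    exact: measurable_funD.
rewrite ge0_integralZl//.
- rewrite IH; last exact: sym_posdef_schur.
  rewrite -EFinM -sqrtrM; last by rewrite divr_ge0 ?ltW.
  rewrite (@det_schur R p A) ?gt_eqF// -/B -/a.
  by congr (Num.sqrt _)%:E; rewrite exprS invfM; ring.
- apply/measurable_EFinP; apply: measurable_gaussian.
  exact: measurable_col_tupleB.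
Qed.

End gaussian_integral.

(** * Second moments of normals truncated to half-lines *)

Section truncated_normal.
Context {R : realType}.
Local Notation mu := (@lebesgue_measure R).

Lemma normal_pdf1E (m x : R) :
  normal_pdf m 1 x = normal_peak 1 * expR (- (x - m) ^+ 2 / 2).
Proof. by rewrite normal_pdfE ?oner_neq0// /normal_fun expr1n. Qed.

(** The factor 2 is chosen so that adding x^2 pdf(x) to the derivative leaves (2 + 2 m x - x^2)
    pdf(x), and 2 m x - x^2 <= m^2. *)
Lemma is_derive_mul_normal_pdf (m x : R) :
  is_derive x 1 (fun z => 2 * (z * normal_pdf m 1 z))
    ((2 + 2 * (m * x) - 2 * x ^+ 2) * normal_pdf m 1 x).
Proof.
have -> : (fun z => 2 * (z * normal_pdf m 1 z)) =
    (fun z : R => 2 * (z * (normal_peak 1 * expR (- (z - m) ^+ 2 / 2)))).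
  by apply/funext => z; rewrite normal_pdf1E.
apply: is_derive_eq.
by rewrite normal_pdf1E /GRing.scale/=; field.
Qed.

(* Integrate the derivative of 2 x pdf(x), which is nonnegative at b and
   nonpositive at a, and bound it by (2 + m^2 - x^2) pdf(x). *)
Lemma normal_pdf_moment_segment (m a b : R) : a <= 0 <= b -> a < b ->
  (\int[mu]_(x in `[a, b]) (x ^+ 2 * normal_pdf m 1 x)%:E <=
   (2 + m ^+ 2)%:E * \int[mu]_(x in `[a, b]) (normal_pdf m 1 x)%:E)%E.
Proof.
move=> /andP[a0 b0] ab.
pose F (z : R) := 2 * (z * normal_pdf m 1 z).
pose f (x : R) := (2 + 2 * (m * x) - 2 * x ^+ 2) * normal_pdf m 1 x.
have cpdf : continuous (normal_pdf m 1) by exact: continuous_normal_pdf.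
have csqr : continuous (fun x : R => x ^+ 2 * normal_pdf m 1 x).
  by move=> x; apply: cvgM; [exact: exprn_continuous|exact: cpdf].
have cf : continuous f.
  move=> x; apply: cvgM; last exact: cpdf.
  apply: cvgB; last first.
    by apply: cvgM; [exact: cvg_cst|exact: exprn_continuous].
  apply: cvgD; first exact: cvg_cst.
  apply: cvgM; first exact: cvg_cst.
  by apply: cvgM; [exact: cvg_cst|].
have cF : continuous F.
  move=> x; apply: differentiable_continuous; apply/derivable1_diffP.
  by have dF := is_derive_mul_normal_pdf m x; exact: ex_derive.
have FTC : (\int[mu]_(x in `[a, b]) (f x)%:E = (F b)%:E - (F a)%:E)%E.
  apply: continuous_FTC2 => //.
  - exact: continuous_subspaceT.
  - split=> [x _| |].
    + by have dF := is_derive_mul_normal_pdf m x; exact: ex_derive.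
    + exact/cvg_at_right_filter/cF.
    + exact/cvg_at_left_filter/cF.
  - move=> x _; rewrite derive1E.
    by have dF := is_derive_mul_normal_pdf m x; exact: derive_val.
have cint g : continuous g -> mu.-integrable `[a, b] (EFin \o g).
  move=> cg; apply: continuous_compact_integrable; first exact: segment_compact.
  exact: continuous_subspaceT.
have f_ge0 : (0 <= \int[mu]_(x in `[a, b]) (f x)%:E)%E.
  rewrite FTC -EFinB lee_fin subr_ge0 /F ler_pM2l// (@le_trans _ _ 0)//.
    by rewrite mulr_le0_ge0// normal_pdf_ge0.
  by rewrite mulr_ge0// normal_pdf_ge0.
apply: (le_trans (leeDl _ f_ge0)).
rewrite -integralD//; [|exact: (cint _ csqr)|exact: (cint _ cf)].
rewrite -integralZl//; last exact: (cint _ cpdf).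
apply: le_integral => //.
- by apply: integrableD => //; [exact: (cint _ csqr)|exact: (cint _ cf)].
- by apply: integrableZl => //; exact: (cint _ cpdf).
move=> x _; rewrite -EFinD -EFinM lee_fin /f -mulrDl ler_wpM2r ?normal_pdf_ge0//.
have := sqr_ge0 (x - m); nra.
Qed.

(** Monotone convergence, in the form that carries a bound from segments to half-lines. *)
Lemma ge0_integral_le_bigcup d (T : measurableType d)
    (nu : {measure set T -> \bar R}) (G : (set T)^nat) (f : T -> \bar R) (K : \bar R) :
  nondecreasing_seq G -> (forall i, measurable (G i)) ->
  measurable_fun setT f -> (forall x, 0 <= f x)%E ->
  (forall i, \int[nu]_(x in G i) f x <= K)%E ->
  (\int[nu]_(x in \bigcup_i G i) f x <= K)%E.
Proof.
move=> ndG mG mf f0 GK.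
have mfG i : measurable_fun (G i) f by exact: measurable_funTS.
have cvgG := ge0_nondecreasing_set_cvg_integral (mu := nu) ndG mG mfG (fun _ _ _ => f0 _).
rewrite -(cvg_lim _ cvgG)//; apply: lime_le; first by apply/cvg_ex; eexists; exact: cvgG.
exact: nearW.
Qed.

(** Segments with one endpoint at 0 exhaust the half-line, and the bound on each has the same
    constant. *)
Lemma normal_pdf_moment_half_line (m : R) (b : bool) :
  (\int[mu]_(x in half_line b) (x ^+ 2 * normal_pdf m 1 x)%:E <=
   (2 + m ^+ 2)%:E * normal_prob m 1 (half_line b))%E.
Proof.
have mpdf : measurable_fun setT (EFin \o normal_pdf m 1).
  by apply/measurable_EFinP; exact: measurable_normal_pdf.
have msqr : measurable_fun setT (fun x : R => (x ^+ 2 * normal_pdf m 1 x)%:E).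
  apply/measurable_EFinP; apply: measurable_funM; last exact: measurable_normal_pdf.
  exact: measurable_funX.
have sqr0 (x : R) : (0 <= (x ^+ 2 * normal_pdf m 1 x)%:E)%E.
  by rewrite lee_fin mulr_ge0 ?sqr_ge0 ?normal_pdf_ge0.
(* The length [k.+1] keeps every segment nondegenerate. In [J] the endpoint 0 is included in both
   cases; adding this point does not change an integral. *)
pose I (k : nat) : interval R := if b then `[0, k.+1%:R] else `[- k.+1%:R, 0].
pose J : interval R := if b then `[0, +oo[ else `]-oo, 0].
have JE g : measurable_fun setT g ->
    (\int[mu]_(x in half_line b) g x = \int[mu]_(x in [set` J]) g x)%E.
  rewrite /J; case: b {I J} => // mg.
  by rewrite integral_itv_obnd_cbnd//; exact: measurable_funTS.
rewrite /normal_prob !JE//.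
have -> : [set` J] = \bigcup_k [set` I k].
  apply/seteqP; split => x.
    move=> Jx; exists (Num.truncn `|x|) => //.
    have := truncnS_gt `|x|.
    move: Jx; rewrite /J /I; case: b {I J JE} => /=; rewrite !in_itv/= ?andbT => x0.
      by rewrite x0 ger0_norm//= => /ltW.
    by rewrite x0 andbT ler0_norm// lerNl => /ltW.
  by move=> [k _]; rewrite /J /I; case: b {I J JE} => /=; rewrite !in_itv/= ?andbT => /andP[].
apply: ge0_integral_le_bigcup => //.
- apply/nondecreasing_seqP => k; apply/subsetPset => x; rewrite /I.
  case: b {I J JE} => /=; rewrite !in_itv/= => /andP[x1 x2]; apply/andP; split => //.
    by rewrite (le_trans x2)// ler_nat.
  by rewrite (le_trans _ x1)// lerN2 ler_nat.
- move=> k; apply: (@le_trans _ _ ((2 + m ^+ 2)%:E *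
      \int[mu]_(x in [set` I k]) (normal_pdf m 1 x)%:E)%E).
    by rewrite /I; case: b {I J JE}; apply: normal_pdf_moment_segment;
      rewrite ?lexx ?oppr_le0 ?ler0n ?oppr_lt0 ?ltr0n.
  apply: lee_wpmul2l; first by rewrite lee_fin addr_ge0// sqr_ge0.
  apply: ge0_subset_integral => //.
  + exact: bigcup_measurable.
  + exact: measurable_funTS.
  + by move=> x _; rewrite lee_fin normal_pdf_ge0.
  + by move=> x Ikx; exists k.
Qed.

Lemma measurable_half_line b : measurable (half_line b : set R).
Proof. by case: b; exact: measurable_itv. Qed.

Lemma truncnormal_pdf_ge0 (m : R) (A : set R) x : 0 <= truncnormal_pdf m A x.
Proof.
by rewrite mulr_ge0 ?indicE// divr_ge0 ?normal_pdf_ge0// fine_ge0.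
Qed.

Lemma measurable_truncnormal_pdf (m : R) (A : set R) : measurable A ->
  measurable_fun setT (truncnormal_pdf m A).
Proof.
move=> mA; apply: measurable_funM; first exact: measurable_indic.
by apply: measurable_funM => //; exact: measurable_normal_pdf.
Qed.

Lemma integral_truncnormal (m : R) (A : set R) (g : R -> R) : measurable A ->
  measurable_fun setT g -> (forall x, 0 <= g x) ->
  (\int[mu]_x (g x * truncnormal_pdf m A x)%:E =
   (fine (normal_prob m 1 A))^-1%:E * \int[mu]_(x in A) (g x * normal_pdf m 1 x)%:E)%E.
Proof.
move=> mA mg g0; set P := fine _.
have P0 : 0 <= P^-1 by rewrite invr_ge0 fine_ge0.
rewrite -ge0_integralZl//.
- rewrite integral_mkcond [RHS]integral_mkcond; apply: eq_integral => x _.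
  rewrite patchE in_setT patchE /truncnormal_pdf indicE -/P.
  case: ifP => _; last by rewrite mul0r mulr0.
  by rewrite mul1r -EFinM; congr EFin; ring.
- apply: measurable_funTS; apply/measurable_EFinP; apply: measurable_funM => //.
  exact: measurable_normal_pdf.
- by move=> x _; rewrite lee_fin mulr_ge0 ?normal_pdf_ge0.
Qed.

(* Only an inequality: a zero normalizer would give the zero density, x / 0
   being 0. *)
Lemma integral_truncnormal_le1 (m : R) (A : set R) : measurable A ->
  (\int[mu]_x (truncnormal_pdf m A x)%:E <= 1)%E.
Proof.
move=> mA; have := integral_truncnormal m mA (measurable_cst (1 : R)) (fun=> ler01).
under eq_integral do rewrite mul1r.
move=> ->; under eq_integral do rewrite mul1r.
rewrite -/(normal_prob m 1 A).
have : normal_prob m 1 A \is a fin_num by exact: fin_num_measure.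
case: (normal_prob m 1 A) => // r _; rewrite -EFinM lee_fin /=.
by have [->|r0] := eqVneq r 0; rewrite ?mulr0// mulVf.
Qed.

Lemma truncnormal_moment_half_line (m : R) (b : bool) :
  (\int[mu]_x (x ^+ 2 * truncnormal_pdf m (half_line b) x)%:E <= (2 + m ^+ 2)%:E)%E.
Proof.
have mA := measurable_half_line b.
have msqr : measurable_fun [set: R] (fun x => x ^+ 2) by exact: measurable_funX.
rewrite (integral_truncnormal m mA msqr (fun=> sqr_ge0 _)).
have := normal_pdf_moment_half_line m b.
have : normal_prob m 1 (half_line b) \is a fin_num by exact: fin_num_measure.
have : (0 <= normal_prob m 1 (half_line b))%E by exact: measure_ge0.
case: (normal_prob m 1 _) => // r r0 _ /= h.
have r1 : (0 <= r^-1%:E)%E by rewrite lee_fin invr_ge0 -lee_fin.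
apply: (le_trans (lee_wpmul2l r1 h)); rewrite -!EFinM lee_fin.
(* Here [r] is the mass of the half-line; if it were 0, the convention that the inverse of 0 is 0
   would make the left side 0. *)
have [->|rn0] := eqVneq r 0; first by rewrite invr0 mul0r addr_ge0// sqr_ge0.
by rewrite mulrCA mulVf// mulr1.
Qed.

End truncated_normal.

(** * Second moments under the two conditional densities *)

Section moments.
Context {R : realType}.
Local Notation RR := (measurableTypeR R).

Lemma prode_le1 n (P : pred 'I_n) (f : 'I_n -> \bar R) :
  (forall i, 0 <= f i <= 1)%E -> (0 <= \prod_(i | P i) f i <= 1)%E.
Proof.
move=> f01; apply: (big_ind (fun x => 0 <= x <= 1)%E) => //.
  by rewrite lee01 lexx.
move=> a b /andP[a0 a1] /andP[b0 b1].
by rewrite mule_ge0//= -[leRHS]mule1 lee_pmul.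
Qed.

Lemma latent_cond_pdf_ge0 n p (X : 'M[R]_(n, p)) (y : 'I_n -> bool)
    (b : 'cV[R]_p) z : 0 <= latent_cond_pdf X y b z.
Proof. by apply: prodr_ge0 => i _; exact: truncnormal_pdf_ge0. Qed.

Lemma measurable_latent_cond_pdf n p (X : 'M[R]_(n, p)) (y : 'I_n -> bool)
    (b : 'cV[R]_p) d (T : measurableType d) (f : T -> 'cV[R]_n) :
  measurable_col f -> measurable_fun setT (fun t => latent_cond_pdf X y b (f t)).
Proof.
move=> mf; apply: measurable_prod => i _.
apply: (measurableT_comp _ (mf i)); apply: measurable_truncnormal_pdf.
exact: measurable_half_line.
Qed.

(** Each summand z_j^2 times the density is a product over coordinates: the j-th factor integrates
    to at most 2 + (x_j^T b)^2 and the others to at most 1. The total mass is only bounded by 1,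
    whence the sign condition on C. *)
Lemma latent_second_moment n p (X : 'M[R]_(n, p)) (y : 'I_n -> bool)
    (b : 'cV[R]_p) (C : R) : 0 <= C ->
  (\int[lebesgue_tuple R n]_t
     ((\sum_i col_tuple t i 0 ^+ 2 + C) * latent_cond_pdf X y b (col_tuple t))%:E
   <= (\sum_i (X *m b) i 0 ^+ 2 + 2 * n%:R + C)%:E)%E.
Proof.
move=> C0.
pose w i (x : RR) := truncnormal_pdf ((X *m b) i 0) (half_line (y i)) x.
(* [g j i] is the i-th factor of the j-th summand; only the factor with i = j carries the square. *)
pose g j i (x : RR) := (if i == j then x ^+ 2 else 1) * w i x.
have mhl i : measurable (half_line (y i) : set R) by exact: measurable_half_line.
have mw i : measurable_fun setT (w i) by exact: measurable_truncnormal_pdf.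
have w0 i x : 0 <= w i x by exact: truncnormal_pdf_ge0.
have w01 i : (0 <= \int[lebesgue_measure]_x (w i x)%:E <= 1)%E.
  rewrite integral_truncnormal_le1// andbT; apply: integral_ge0 => x _.
  by rewrite lee_fin.
have mg j i : measurable_fun setT (g j i).
  apply: measurable_funM => //; case: eqP => _ //.
have g0 j i x : 0 <= g j i x by rewrite mulr_ge0//; case: ifP; rewrite // sqr_ge0.
have mprod (h : 'I_n -> RR -> R) : (forall i, measurable_fun setT (h i)) ->
    measurable_fun setT (fun t : n.-tuple RR => (\prod_i h i (tnth t i))%:E).
  move=> mh; apply/measurable_EFinP; apply: measurable_prod => i _.
  exact: (measurableT_comp (mh i) (measurable_tnth i)).
rewrite [leLHS](_ : _ = (\int[lebesgue_tuple R n]_t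
    (\sum_j (\prod_i g j i (tnth t i))%:E + C%:E * (\prod_i w i (tnth t i))%:E))%E);
  last first.
  apply: eq_integral => t _.
  rewrite sumEFin -EFinM -EFinD; congr EFin.
  have -> : latent_cond_pdf X y b (col_tuple t) = \prod_i w i (tnth t i).
    by apply: eq_bigr => i _; rewrite [col_tuple t i 0]mxE.
  rewrite mulrDl mulr_suml; congr (_ + _); apply: eq_bigr => j _.
  by rewrite /g [in RHS]big_split /= -big_mkcond big_pred1_eq [col_tuple t j 0]mxE.
rewrite ge0_integralD//; first last.
- by apply: measurable_funeM; exact: mprod.
- by move=> t _; rewrite -EFinM lee_fin mulr_ge0// prodr_ge0.
- by apply: emeasurable_sum => j; exact: mprod.
- by move=> t _; apply: sume_ge0 => j _; rewrite lee_fin prodr_ge0.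
rewrite ge0_integral_sum//; first last.
- by move=> j t _; rewrite lee_fin prodr_ge0.
- by move=> j; exact: mprod.
rewrite ge0_integralZl//; first last.
- by move=> t _; rewrite lee_fin prodr_ge0.
- exact: mprod.
rewrite EFinD; apply: leeD; last first.
  rewrite -[leRHS]mule1 lee_wpmul2l// ge0_integral_lebesgue_tuple_prod//.
  by have /andP[] := prode_le1 xpredT w01.
have -> : \sum_i (X *m b) i 0 ^+ 2 + 2 * n%:R = \sum_i (2 + (X *m b) i 0 ^+ 2).
  by rewrite big_split /= sumr_const card_ord addrC mulr_natr.
rewrite -sumEFin; apply: lee_sum => j _.
rewrite ge0_integral_lebesgue_tuple_prod// (bigD1 j)//= -[leRHS]mule1.
have /andP[p0 p1] : (0 <= \prod_(i | i != j) \int[lebesgue_measure]_x (g j i x)%:E <= 1)%E.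
  rewrite (_ : (\prod_(i | _) _ = \prod_(i | i != j) \int[lebesgue_measure]_x (w i x)%:E)%E).
    exact: prode_le1.
  apply: eq_bigr => i /negPf ij; apply: eq_integral => x _.
  by rewrite /g ij mul1r.
apply: lee_pmul => //.
  by apply: integral_ge0 => x _; rewrite lee_fin.
rewrite /g eqxx; exact: truncnormal_moment_half_line.
Qed.

(** The constant is uniform in the mean because the term left after Young's inequality depends only
    on x - m, and Gaussian integrals are translation invariant. *)
Lemma mvnormal_second_moment p (A : 'M[R]_p) (e : R) : sym_posdef A -> 0 < e ->
  exists2 K : R, 0 <= K & forall m : 'cV[R]_p,
  (\int[lebesgue_tuple R p]_t
     (quad_form A (col_tuple t) * mvnormal_pdf m (invmx A) (col_tuple t))%:E
   <= ((1 + e) * quad_form A m + K)%:E)%E.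
Proof.
move=> pA e0.
pose c := (Num.sqrt ((2 * pi) ^+ p * \det (invmx A)))^-1.
have c0 : 0 <= c by rewrite invr_ge0 sqrtr_ge0.
(* [I2] is the integral of exp(-q / 4), a Gaussian for half of [A]. In [k], the factor 1 + 1/e comes
   from Young's inequality, 4 from the bound on q exp(-q / 2), and [c] is the normalising
   constant. *)
pose I2 := Num.sqrt ((2 * pi) ^+ p / \det (2^-1 *: A)).
pose k := (1 + e^-1) * 4 * c.
have k0 : 0 <= k by rewrite !mulr_ge0// addr_ge0// invr_ge0 ltW.
exists (k * I2); first by rewrite mulr_ge0// sqrtr_ge0.
move=> m.
have q0 x := quad_form_ge0 x pA.
have h0 : 0 <= (1 + e) * quad_form A m * c.
  by rewrite !mulr_ge0// addr_ge0// ltW.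
have p2A : sym_posdef (2^-1 *: A) by apply: sym_posdefZ => //; rewrite invr_gt0.
apply: (@le_trans _ _ (\int[lebesgue_tuple R p]_t
   (((1 + e) * quad_form A m * c)%:E * (expR (- quad_form A (col_tuple t - m) / 2))%:E +
    k%:E * (expR (- quad_form (2^-1 *: A) (col_tuple t - m) / 2))%:E))%E).
  apply: ge0_le_integral => //.
  - move=> t _; rewrite lee_fin mulr_ge0// mulr_ge0 ?expR_ge0//.
  - apply/measurable_EFinP; apply: measurable_funM.
      by apply: measurable_quad_form; exact: measurable_col_tuple.
    apply: measurable_funM => //; apply: measurable_gaussian.
    exact: measurable_col_tupleB.
  - apply: emeasurable_funD; apply: measurable_funeM;
      apply/measurable_EFinP; apply: measurable_gaussian;
      exact: measurable_col_tupleB.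
  move=> t _; rewrite -!EFinM -EFinD lee_fin /mvnormal_pdf -/c invmxK.
  set x := col_tuple t; set r := x - m.
  have hq : quad_form A x <= (1 + e) * quad_form A m + (1 + e^-1) * quad_form A r.
    by rewrite -[x](subrKC m) quad_form_young.
  rewrite quad_formZmx; set q := quad_form A r in hq *.
  have hexp : q * expR (- q / 2) <= 4 * expR (- (2^-1 * q) / 2).
    have -> : - q / 2 = - (2^-1 * q) / 2 + - (q / 4) by field.
    rewrite expRD mulrCA mulrC ler_wpM2r ?expR_ge0//.
    rewrite expRN ler_pdivrMr ?expR_gt0//.
    (* From exp(q / 4) >= 1 + q / 4 follows q <= 4 exp(q / 4). *)
    by have := expR_ge1Dx (q / 4); lra.
  apply: (@le_trans _ _
      (((1 + e) * quad_form A m + (1 + e^-1) * q) * (c * expR (- q / 2)))).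
    by rewrite ler_wpM2r// mulr_ge0 ?expR_ge0.
  rewrite mulrDl; apply: lerD; first by rewrite mulrA.
  have -> : (1 + e^-1) * q * (c * expR (- q / 2)) =
     (1 + e^-1) * c * (q * expR (- q / 2)) by ring.
  have -> : k * expR (- (2^-1 * q) / 2) =
     (1 + e^-1) * c * (4 * expR (- (2^-1 * q) / 2)) by rewrite /k; ring.
  by rewrite ler_wpM2l// mulr_ge0// addr_ge0// invr_ge0 ltW.
have mgauss (B : 'M[R]_p) : measurable_fun setT
    (fun t => (expR (- quad_form B (col_tuple t - m) / 2))%:E).
  by apply/measurable_EFinP; apply: measurable_gaussian; exact: measurable_col_tupleB.
rewrite ge0_integralD//; first last.
- exact: measurable_funeM.
- by move=> t _; rewrite -EFinM lee_fin mulr_ge0 ?expR_ge0.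
- exact: measurable_funeM.
- by move=> t _; rewrite -EFinM lee_fin mulr_ge0 ?expR_ge0.
rewrite !ge0_integralZl//; try by move=> t _; rewrite lee_fin expR_ge0.
rewrite !integral_gaussian// -!EFinM -EFinD lee_fin -/I2 lerD2r.
have d0 := sym_posdef_det_gt0 pA.
(* The constant [c] cancels the Gaussian integral, as the determinant of the inverse is the inverse
   determinant. *)
rewrite -(mulrA _ c) [X in _ * X](_ : _ = 1) ?mulr1// /c det_inv mulVf// gt_eqF//.
by rewrite sqrtr_gt0 divr_gt0// exprn_gt0// mulr_gt0// pi_gt0.
Qed.

End moments.

(** * Assembly of the drift inequality by Tonelli *)

Theorem theorem1 (R : realType) (n p : nat) (hn : (0 < n)%N) (hp : (0 < p)%N)
    (X : 'M[R]_(n, p)) (y : 'I_n -> bool) (Q : 'M[R]_p) (v : 'cV[R]_p)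
    (hQ : sym_posdef Q) :
  exists rho L : R, 0 < rho < 1 /\
    forall beta' : 'cV[R]_p,
      (integral_cV [set: 'cV[R]_p]
         (fun beta => (drift_fun X Q beta)%:E * acda_density X y Q v beta' beta)
       <= (rho * drift_fun X Q beta' + L)%:E)%E.
Proof.
have [lam [C [/andP[lam0 lam1] C0 Xlam qC]]] := posterior_mean_bound X v hQ.
have pA := sym_posdef_gramD X hQ.
(* This choice makes (1 + e) lam = 1 - (1 - lam)^2, which is below 1. *)
pose e := 1 - lam; have e0 : 0 < e by rewrite /e; lra.
have [K K0 hK] := mvnormal_second_moment pA e0.
(* Absorbs [K] into the bracket: (1 + e) (|z|^2 + C) + K = (1 + e) (|z|^2 + C'). *)
pose C' := C + K / (1 + e).
have e1 : 0 < 1 + e by lra.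
have C'0 : 0 <= C' by rewrite addr_ge0// divr_ge0// ltW.
exists ((1 + e) * lam), ((1 + e) * (2 * n%:R + C')); split.
  by rewrite mulr_gt0//=; rewrite /e; nra.
move=> b.
pose lat (t : n.-tuple (measurableTypeR R)) := latent_cond_pdf X y b (col_tuple t).
pose nu (s : p.-tuple (measurableTypeR R)) := drift_fun X Q (col_tuple s).
pose pb s t := beta_cond_pdf X Q v (col_tuple t) (col_tuple s) : R.
have lat0 t : 0 <= lat t by exact: latent_cond_pdf_ge0.
have nu0 s : 0 <= nu s by exact: quad_form_ge0.
have pb0 s t : 0 <= pb s t by rewrite mulr_ge0 ?expR_ge0 ?invr_ge0 ?sqrtr_ge0.
have mcol1 : measurable_col (fun u : p.-tuple (measurableTypeR R) *
    n.-tuple (measurableTypeR R) => col_tuple u.1 : 'cV[R]_p).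
  by move=> i; exact: (measurableT_comp (@measurable_col_tuple R p i) measurable_fst).
have mcol2 : measurable_col (fun u : p.-tuple (measurableTypeR R) *
    n.-tuple (measurableTypeR R) => col_tuple u.2 : 'cV[R]_n).
  by move=> i; exact: (measurableT_comp (@measurable_col_tuple R n i) measurable_snd).
have mlat : measurable_fun setT lat.
  by apply: measurable_latent_cond_pdf; exact: measurable_col_tuple.
have mnu : measurable_fun setT nu.
  by apply: measurable_quad_form; exact: measurable_col_tuple.
have mpb : measurable_fun setT (fun u : p.-tuple (measurableTypeR R) *
    n.-tuple (measurableTypeR R) => pb u.1 u.2).
  apply: measurable_funM => //; apply: measurable_gaussian.
  apply: measurable_colD => //; apply: measurable_colN.
  apply: measurable_col_mulmx; apply: measurable_colD.
    exact: measurable_col_cst.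
  exact: measurable_col_mulmx.
pose F (u : p.-tuple (measurableTypeR R) * n.-tuple (measurableTypeR R)) :=
  (nu u.1 * (pb u.1 u.2 * lat u.2))%:E.
have mF : measurable_fun setT F.
  apply/measurable_EFinP; apply: measurable_funM.
    exact: (measurableT_comp mnu measurable_fst).
  apply: measurable_funM => //.
  exact: (measurableT_comp mlat measurable_snd).
have F0 u : (0 <= F u)%E by rewrite lee_fin !mulr_ge0.
have mpbs s : measurable_fun setT (pb s).
  exact: (measurableT_comp mpb (measurable_pair1 s)).
have mpbt t : measurable_fun setT (pb ^~ t).
  exact: (measurableT_comp mpb (measurable_pair2 t)).
rewrite /integral_cV preimage_setT.
have -> : (\int[lebesgue_tuple R p]_t
    ((drift_fun X Q (col_tuple t))%:E * acda_density X y Q v b (col_tuple t)) =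
    \int[lebesgue_tuple R p]_s \int[lebesgue_tuple R n]_t F (s, t))%E.
  apply: eq_integral => s _.
  have -> : acda_density X y Q v b (col_tuple s) =
      (\int[lebesgue_tuple R n]_t (pb s t * lat t)%:E)%E.
    (* Outside the latent space some indicator in [latent_cond_pdf] is 0, so the integral may be
       taken over all tuples. *)
    rewrite /acda_density /integral_cV integral_mkcond.
    apply: eq_integral => t _; rewrite patchE.
    case: ifPn => // /negP tZ; congr EFin.
    have /existsNP[i /= zi] : ~ forall i, half_line (y i) (col_tuple t i 0).
      by move=> tH; apply: tZ; rewrite inE.
    rewrite /lat /latent_cond_pdf (bigD1 i)//= {1}/truncnormal_pdf indicE.
    by rewrite memNset// mul0r mul0r mulr0.
  rewrite -ge0_integralZl//.
  - by apply/measurable_EFinP; exact: measurable_funM.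
  - by move=> t _; rewrite lee_fin mulr_ge0.
  - by rewrite lee_fin; exact: nu0.
rewrite fubini_tonelli//.
apply: (@le_trans _ _ (\int[lebesgue_tuple R n]_t
   ((1 + e)%:E * ((\sum_i col_tuple t i 0 ^+ 2 + C') * lat t)%:E))%E).
  apply: ge0_le_integral => //.
  - by move=> t _; apply: integral_ge0.
  - exact: measurable_fun_fubini_tonelli_G.
  - apply: measurable_funeM; apply/measurable_EFinP; apply: measurable_funM => //.
    apply: measurable_funD => //; apply: measurable_sum => i.
    by apply: measurable_funX; exact: measurable_col_tuple.
  move=> t _.
  (* After the exchange the latent density is constant in the inner integral, which becomes the
     second moment bounded by [hK] at the posterior mean; [qC] then bounds the form at that mean. *)
  have -> : (\int[lebesgue_tuple R p]_s F (s, t) =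
      (lat t)%:E * \int[lebesgue_tuple R p]_s (nu s * pb s t)%:E)%E.
    rewrite -ge0_integralZl//.
    - by apply: eq_integral => s _; rewrite /F/= -EFinM mulrA mulrC.
    - by apply/measurable_EFinP; exact: measurable_funM.
    - by move=> s _; rewrite lee_fin mulr_ge0.
    - by rewrite lee_fin.
  apply: (le_trans (lee_wpmul2l _ (hK _))); first by rewrite lee_fin.
  rewrite -!EFinM lee_fin mulrA mulrC ler_wpM2r//.
  have -> : (1 + e) * (\sum_i col_tuple t i 0 ^+ 2 + C') =
      (1 + e) * (\sum_i col_tuple t i 0 ^+ 2 + C) + K.
    by rewrite /C'; field; rewrite gt_eqF.
  by rewrite lerD2r ler_pM2l.
rewrite ge0_integralZl//; first last.
- by rewrite lee_fin ltW.
- move=> t _; rewrite lee_fin mulr_ge0// addr_ge0// sumr_ge0// => i _; exact: sqr_ge0.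
- apply/measurable_EFinP; apply: measurable_funM => //.
  apply: measurable_funD => //; apply: measurable_sum => i.
  by apply: measurable_funX; exact: measurable_col_tuple.
apply: (le_trans (lee_wpmul2l _ (latent_second_moment X y b C'0))).
  by rewrite lee_fin ltW.
rewrite -EFinM lee_fin -mulrA -mulrDr ler_pM2l// -addrA lerD2r.
exact: Xlam.
Qed.
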